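(* For every $n\in\mathbb{N}$ and all $T\in\mathcal{S}^n$, $$\rho_1(T)\le \pi_+(T)\le C_n\,\rho_1(T).$$
   Context: Let $\mathbb{F}$ be $\mathbb{R}$ or $\mathbb{C}$. $\mathcal{S}^n$ is the real vector space of self-adjoint (symmetric or Hermitian) $n\times n$ matrices over $\mathbb{F}$ and $\mathcal{S}_+^n\subset\mathcal{S}^n$ the cone of positive semidefinite matrices. $\|x\|_1=\sum_i|x(i)|$ for $x\in\mathbb{F}^n$ and $\|A\|_{1,1}=\sum_{k,l=1}^n|A(k,l)|$. For $A\in\mathcal{S}_+^n$, $\gamma_+(A) := \inf\{\sum_{k=1}^N \|x_k\|_1^2 : N\in\mathbb{N},\ x_k\in\mathbb{F}^n,\ A = \sum_{k=1}^N x_kx_k^*\}$, and $C_n:=\sup_{A\in\mathcal{S}_+^n\setminus\{0\}}\gamma_+(A)/\|A\|_{1,1}$. For $T\in\mathcal{S}^n$, $\rho_1(T):=\sup\{\langle Tx,x\rangle : x\in\mathbb{F}^n,\ \|x\|_1\le 1\}$ and $\pi_+(T):=\sup\{\mathrm{tr}(TA): A\in\mathcal{S}_+^n,\ \|A\|_{1,1}\le 1\}$. *)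

(* Defs.v *)
From HB Require Import structures.
From mathcomp Require Import all_boot all_order all_algebra.
From mathcomp Require Import complex.
From mathcomp Require Import boolp classical_sets reals ereal.
Set Implicit Arguments.
Unset Strict Implicit.
Unset Printing Implicit Defensive.
Import Order.TTheory GRing.Theory Num.Theory.
Local Open Scope classical_set_scope.
Local Open Scope ring_scope.
Local Open Scope sesquilinear_scope.

Variant scalar_kind := RealScalars | ComplexScalars.

Definition scalar_field (R : realType) (K : scalar_kind) : numFieldType :=
  match K with RealScalars => R | ComplexScalars => R[i] end.

Definition scalar_conj (R : realType) (K : scalar_kind) :
    {rmorphism scalar_field R K -> scalar_field R K} :=
  match K with
  | RealScalars => @idfun R
  | ComplexScalars => @conjc R
  end.

Definition scalar_re (R : realType) (K : scalar_kind) : scalar_field R K -> R :=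
  match K with
  | RealScalars => @idfun R
  | ComplexScalars => @complex.Re R
  end.

Section MatrixNorms.
Context (R : realType) (K : scalar_kind).
Local Notation F := (scalar_field R K).
Local Notation re := (@scalar_re R K).
Local Notation conj := (@scalar_conj R K).

Section FixedSize.
Context (n : nat).
Implicit Types (A T : 'M[F]_n) (x y : 'cV[F]_n).

Definition selfadjoint A : bool := A \is hermitianmx n false conj.

Definition inner x y : F := (y ^t conj *m x) 0 0.

(* On R[i], 0 <= z means that z is real and nonnegative. *)
Definition psd A : Prop :=
  selfadjoint A /\ forall x, 0 <= inner (A *m x) x.

(* A norm in R[i] is an element of R[i] with zero imaginary part, hence re. *)
Definition norm1 x : R := \sum_i re `|x i 0|.

Definition norm11 A : R := \sum_k \sum_l re `|A k l|.

Definition gamma_plus A : \bar R :=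
  ereal_inf [set s | exists (N : nat) (x : 'I_N -> 'cV[F]_n),
    A = \sum_k x k *m (x k) ^t conj /\ s = (\sum_k norm1 (x k) ^+ 2)%:E].

(* For T and A self-adjoint, inner (T *m x) x and \tr (T *m A) are real. *)
Definition rho1 T : \bar R :=
  ereal_sup [set (re (inner (T *m x) x))%:E | x in [set x | norm1 x <= 1]].

Definition pi_plus T : \bar R :=
  ereal_sup [set (re (\tr (T *m A)))%:E
            | A in [set A | psd A /\ norm11 A <= 1]].

End FixedSize.

Definition C_const (n : nat) : \bar R :=
  ereal_sup [set (gamma_plus A / (norm11 A)%:E)%E
            | A in [set A : 'M[F]_n | psd A /\ A != 0]].

End MatrixNorms.

(* Main.v *)
(* The lower bound tests pi_plus on x x^*, whose (1,1)-norm is |x|_1^2.  For the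
   upper bound, A = sum_k x_k x_k^* gives tr(TA) = sum_k <T x_k, x_k>, which is at
   most rho_1(T) sum_k |x_k|_1^2 by homogeneity; taking the infimum over
   decompositions gives tr(TA) <= gamma_+(A) rho_1(T) <= C_n |A|_{1,1} rho_1(T).
   When rho_1(T) = 0 the last chain is useless if gamma_+(A) = +oo, and one needs
   that A has at least one decomposition, obtained here by successive Schur
   complements. *)
Require Import Defs.
From mathcomp Require Import all_boot all_order all_algebra.
From mathcomp Require Import boolp classical_sets reals ereal.
From mathcomp Require Import complex ring.
Import Order.TTheory GRing.Theory Num.Theory.
Set Implicit Arguments.
Unset Strict Implicit.
Unset Printing Implicit Defensive.

(** * Conjugation, real part and square roots, uniformly in the two scalar fields *)

Section Scalars.
Local Open Scope ring_scope.
Context (R : realType) (K : scalar_kind).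
Local Notation F := (scalar_field R K).
Local Notation re := (@scalar_re R K).
Local Notation conj := (@scalar_conj R K).
Implicit Types (z w : F).

Lemma mul_scalar_conj z : z * conj z = `|z| ^+ 2.
Proof.
case: K z => [|] /= z; last by rewrite sqr_normc.
by rewrite -normrX ger0_norm ?sqr_ge0// expr2.
Qed.

Lemma scalar_conjK : involutive conj.
Proof. by case: K => [|] //=; exact: conjcK. Qed.

Lemma ge0_scalar_conj z : 0 <= z -> conj z = z.
Proof.
case: K z => [|] //= -[a b]; rewrite lecE /= => /andP[/eqP -> _].
by rewrite oppr0.
Qed.

Lemma scalar_re0 : re 0 = 0.
Proof. by case: K. Qed.

Lemma scalar_re1 : re 1 = 1.
Proof. by case: K. Qed.

Lemma scalar_reD z w : re (z + w) = re z + re w.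
Proof. by case: K z w => [|] //= [a b] [c d]. Qed.

Lemma scalar_re_sum (I : Type) (s : seq I) (P : pred I) (f : I -> F) :
  re (\sum_(i <- s | P i) f i) = \sum_(i <- s | P i) re (f i).
Proof. exact: (big_morph re scalar_reD scalar_re0). Qed.

Lemma ge0_scalar_reM z w : 0 <= z -> re (z * w) = re z * re w.
Proof.
case: K z w => [|] //= -[a b] [c d]; rewrite lecE /= => /andP[/eqP -> _].
by rewrite mul0r subr0.
Qed.

Lemma scalar_re_ge0 z : 0 <= z -> 0 <= re z.
Proof. by case: K z => [|] //= -[a b]; rewrite lecE => /andP[]. Qed.

Lemma ge0_scalar_re_eq0 z : 0 <= z -> re z = 0 -> z = 0.
Proof.
by case: K z => [|] //= -[a b]; rewrite lecE /= => /andP[/eqP -> _] ->.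
Qed.

Lemma scalar_re_le_norm z : re z <= re `|z|.
Proof.
case: K z => [|] /= z; first exact: ler_norm.
have := normc_ge_Re z; rewrite lecE /= => /andP[_].
exact/le_trans/ler_norm.
Qed.

(** A nonnegative [z] has a real square root, which is its own conjugate. This supplies the scaling
    factor of the vector split off in a Schur complement. *)
Lemma ge0_mul_conj_sqrt z : 0 <= z -> exists c, c * conj c = z.
Proof.
case: K z => [|] /= z z0.
  by exists (Num.sqrt z); rewrite -expr2 sqr_sqrtr.
exists (sqrtc z); rewrite -sqr_normc ger0_norm ?sqrtc_ge0//.
exact: sqr_sqrtc.
Qed.

End Scalars.

Section PositiveSemidefinite.
Local Open Scope ring_scope.
Local Open Scope sesquilinear_scope.
Context (R : realType) (K : scalar_kind) (n : nat).
Local Notation F := (scalar_field R K).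
Local Notation re := (@scalar_re R K).
Local Notation conj := (@scalar_conj R K).
Implicit Types (A T : 'M[F]_n) (x y : 'cV[F]_n).

(** * Self-adjointness and the sesquilinear form in coordinates *)

Lemma selfadjointP A :
  reflect (forall i j, A i j = conj (A j i)) (selfadjoint A).
Proof.
rewrite /selfadjoint is_hermitianmxE expr0 scale1r.
apply: (iffP eqP) => [H i j|H].
  by rewrite {1}H !mxE.
by apply/matrixP => i j; rewrite H !mxE.
Qed.

Lemma innerE x y : inner x y = \sum_i conj (y i 0) * x i 0.
Proof. by rewrite /inner !mxE; apply: eq_bigr => i _; rewrite !mxE. Qed.

Lemma innerBl x y z : inner (x - y) z = inner x z - inner y z.
Proof. by rewrite /inner mulmxBr !mxE. Qed.

Lemma innerZl c x y : inner (c *: x) y = c * inner x y.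
Proof. by rewrite /inner -scalemxAr !mxE. Qed.

Lemma innerC x y : inner x y = conj (inner y x).
Proof.
rewrite !innerE rmorph_sum; apply: eq_bigr => i _.
by rewrite rmorphM /= scalar_conjK mulrC.
Qed.

Lemma innerBr x y z : inner x (y - z) = inner x y - inner x z.
Proof. by rewrite innerC innerBl rmorphB -!innerC. Qed.

Lemma innerZr c x y : inner x (c *: y) = conj c * inner x y.
Proof. by rewrite innerC innerZl rmorphM -!innerC. Qed.

Lemma inner_delta x k : inner x (delta_mx k 0) = x k 0.
Proof.
rewrite innerE (bigD1 k)//= !mxE !eqxx rmorph1 mul1r big1 ?addr0// => i ik.
by rewrite !mxE (negPf ik) rmorph0 mul0r.
Qed.

Lemma mul_delta A k i : (A *m delta_mx k 0 : 'cV_n) i 0 = A i k.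
Proof. by rewrite -colE mxE. Qed.

Lemma selfadjoint_inner A x y : selfadjoint A ->
  inner (A *m x) y = inner x (A *m y).
Proof.
move=> /selfadjointP hA; rewrite !innerE.
under eq_bigr do rewrite mxE mulr_sumr.
under [RHS]eq_bigr do rewrite mxE rmorph_sum mulr_suml.
rewrite exchange_big; apply: eq_bigr => i _; apply: eq_bigr => j _ /=.
by rewrite rmorphM /= (hA j i); ring.
Qed.

(** * Rank-one matrices and the decomposition of positive semidefinite matrices *)

Definition rank_one x : 'M[F]_n := x *m x ^t conj.

Lemma rank_oneE x i j : rank_one x i j = x i 0 * conj (x j 0).
Proof. by rewrite /rank_one !mxE big_ord1 !mxE. Qed.

Lemma mul_rank_one x y : rank_one x *m y = inner y x *: x.
Proof.
rewrite /rank_one -mulmxA; apply/colP => i.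
by rewrite !mxE big_ord1 mulrC.
Qed.

Lemma inner_rank_one x y : inner (rank_one x *m y) y = inner y x * conj (inner y x).
Proof. by rewrite mul_rank_one innerZl -innerC. Qed.

Lemma psd_rank_one x : psd (rank_one x).
Proof.
split=> [|y]; last by rewrite inner_rank_one mul_scalar_conj exprn_ge0.
by apply/selfadjointP => i j; rewrite !rank_oneE rmorphM /= scalar_conjK mulrC.
Qed.

Lemma psd_diag_ge0 A k : psd A -> 0 <= A k k.
Proof. by move=> [_ /(_ (delta_mx k 0))]; rewrite inner_delta mul_delta. Qed.

(* For real t >= 0 the form at e_i - t (conj (A i k)) e_k equals
   A i i - 2 t |A i k|^2, which is -1 for a suitable t if A i k != 0. *)
Lemma psd_diag_eq0 A k i : psd A -> A k k = 0 -> A i k = 0.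
Proof.
move=> pA Akk; apply/eqP/negPn/negP => Aik.
have [sA qA] := pA; have Aii := psd_diag_ge0 i pA.
set N := `|A i k| ^+ 2.
have N0 : 0 < N by rewrite exprn_gt0// normr_gt0.
have N20 : N *+ 2 != 0 by rewrite mulrn_eq0 negb_or /= lt0r_neq0.
have [t t0 tE] : exists2 t, 0 <= t & t * (N *+ 2) = A i i + 1.
  exists ((A i i + 1) / (N *+ 2)); last by rewrite divfK.
  by rewrite divr_ge0 ?addr_ge0// ltW.
have := qA (delta_mx i 0 - (t * conj (A i k)) *: delta_mx k 0).
rewrite mulmxBr -scalemxAr !innerBl !innerBr !innerZl !innerZr !inner_delta.
rewrite !mul_delta Akk (selfadjointP _ sA k i) !rmorphM /= scalar_conjK.
rewrite (ge0_scalar_conj t0).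
have -> : A i i - t * A i k * conj (A i k) -
    (t * conj (A i k) * A i k - t * conj (A i k) * (t * A i k * 0)) =
    A i i - t * (A i k * conj (A i k) *+ 2) by ring.
rewrite mul_scalar_conj -/N tE opprD addrA subrr add0r.
by rewrite oppr_ge0 ler10.
Qed.

(** The vector is column [k] of [A] divided by a square root of [A k k]; positivity of the remainder
    follows by completing the square. The last clause ensures that iterating the step never revives
    a diagonal entry that is already zero. *)
Lemma psd_schur A k : psd A -> A k k != 0 ->
  exists v, [/\ psd (A - rank_one v), (A - rank_one v) k k = 0 &
    forall i, A i i = 0 -> (A - rank_one v) i i = 0].
Proof.
move=> pA Akk; have [sA qA] := pA; have a0 := psd_diag_ge0 k pA.
have [c cE] : exists c, c * conj c = (A k k)^-1.
  by apply: ge0_mul_conj_sqrt; rewrite invr_ge0.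
pose v : 'cV[F]_n := c *: (A *m delta_mx k 0).
have vE i : v i 0 = c * A i k by rewrite mxE mul_delta.
have aE : conj (A k k) = A k k by rewrite ge0_scalar_conj.
exists v; split.
- split.
    apply/selfadjointP => i j; rewrite mxE [X in _ + X]mxE [in RHS]mxE.
    rewrite [X in _ = conj (_ + X)]mxE rmorphB.
    by rewrite -(selfadjointP _ sA) -(selfadjointP _ (psd_rank_one v).1).
  move=> x; pose u := (A *m x) k 0.
  (* This vector minimises the form of [A] on the line through [x] in direction [e_k]. The minimum
     is [inner (A *m x) x - |u|^2 / A k k], exactly the form of [A - rank_one v] at [x]. *)
  have := qA (x - (u / A k k) *: delta_mx k 0).
  rewrite mulmxBr -scalemxAr !innerBl !innerBr !innerZl !innerZr !inner_delta.
  rewrite mul_delta mulmxBl innerBl inner_rank_one.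
  have -> : inner (A *m delta_mx k 0) x = conj u.
    by rewrite selfadjoint_inner// innerC inner_delta.
  have -> : inner x v = conj c * u.
    by rewrite innerZr -selfadjoint_inner// inner_delta.
  rewrite !rmorphM /= fmorphV /= aE scalar_conjK -/u.
  rewrite (mulrACA (conj c)) (mulrC (conj c)) cE.
  set q := inner _ _; set w := conj u => h.
  suff <- : w / A k k * u = (A k k)^-1 * (u * w) by rewrite divfK// subrr subr0 in h.
  by rewrite (mulrC w) -mulrA (mulrC w).
- rewrite mxE [X in _ + X]mxE rank_oneE vE rmorphM /= aE.
  rewrite mulrACA cE; by rewrite mulKf// subrr.
- move=> i Aii; rewrite mxE [X in _ + X]mxE rank_oneE vE Aii.
  (* A zero diagonal entry forces its whole row to vanish, so [v] is zero at [i]. *)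
  have -> : A i k = 0.
    by rewrite (selfadjointP _ sA) (psd_diag_eq0 k pA Aii) rmorph0.
  by rewrite mulr0 mul0r subr0.
Qed.

(* Each Schur complement kills a diagonal entry and keeps the zero ones, and a
   psd matrix with zero diagonal vanishes. *)
Lemma psd_sum_rank_one A : psd A ->
  exists (N : nat) (x : 'I_N -> 'cV[F]_n), A = \sum_k rank_one (x k).
Proof.
have [m] := ubnP #|[set i | A i i != 0]|.
elim: m A => // m IH A; rewrite ltnS => Am pA.
have [/existsP[k Akk]|/existsPn A0] := boolP [exists k, A k k != 0]; last first.
  exists 0%N, (fun=> 0); rewrite big_ord0; apply/matrixP => i j.
  by rewrite (psd_diag_eq0 i pA) ?mxE//; apply/eqP; have := A0 j; rewrite negbK.
have [v [pB Bk Bi]] := psd_schur pA Akk.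
have [|//|N [x xE]] := IH (A - rank_one v).
  apply: leq_trans Am; apply: proper_card; apply/properP; split.
    by apply/fintype.subsetP => i; rewrite !inE; apply: contraNneq => /Bi ->.
  by exists k; rewrite inE ?Bk ?eqxx.
exists N.+1, (fun i => oapp x v (unlift ord0 i)).
rewrite big_ord_recl unlift_none /=; apply/eqP.
rewrite addrC -subr_eq xE; apply/eqP; apply: eq_bigr => i _.
by rewrite liftK.
Qed.

(** * The entrywise norms and bounds on the quadratic form *)

Lemma norm1_ge0 x : 0 <= norm1 x.
Proof. by apply: sumr_ge0 => i _; apply: scalar_re_ge0. Qed.

Lemma norm11_ge0 A : 0 <= norm11 A.
Proof.
by apply: sumr_ge0 => i _; apply: sumr_ge0 => j _; apply: scalar_re_ge0.
Qed.

Lemma norm11_gt0 A : A != 0 -> 0 < norm11 A.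
Proof.
rewrite lt0r norm11_ge0 andbT; apply: contra_neq => /eqP.
rewrite psumr_eq0; last first.
  by move=> i _; apply: sumr_ge0 => j _; apply: scalar_re_ge0.
move=> /allP A0; apply/matrixP => i j; rewrite mxE.
have := A0 i (mem_index_enum i); rewrite /= psumr_eq0; last first.
  by move=> ? _; apply: scalar_re_ge0.
move=> /allP/(_ j (mem_index_enum j))/= /eqP Aij.
by apply/eqP; rewrite -normr_eq0; apply/eqP/ge0_scalar_re_eq0.
Qed.

Lemma scalar_norm_conj (z : F) : `|conj z| = `|z|.
Proof.
apply/eqP; rewrite -(@eqrXn2 _ 2)// -!mul_scalar_conj scalar_conjK.
by rewrite mulrC.
Qed.

Lemma norm11_rank_one x : norm11 (rank_one x) = norm1 x ^+ 2.
Proof.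
rewrite /norm11 /norm1 expr2 mulr_suml; apply: eq_bigr => i _.
rewrite mulr_sumr; apply: eq_bigr => j _.
by rewrite rank_oneE normrM scalar_norm_conj ge0_scalar_reM.
Qed.

Lemma trace_mul_rank_one T x : \tr (T *m rank_one x) = inner (T *m x) x.
Proof. by rewrite /rank_one mulmxA mxtrace_mulC /mxtrace big_ord1. Qed.

(** Every coordinate of [x] has modulus at most 1, so each term of the double sum is at most the
    modulus of an entry of [T]. This crude bound serves to make [rho1 T] finite. *)
Lemma re_inner_le_norm11 T x : norm1 x <= 1 -> re (inner (T *m x) x) <= norm11 T.
Proof.
move=> x1.
have xi1 i : re `|x i 0| <= 1.
  apply: le_trans x1; rewrite /norm1 (bigD1 i)//= lerDl.
  by apply: sumr_ge0 => j _; apply: scalar_re_ge0.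
rewrite innerE scalar_re_sum; apply: ler_sum => i _.
rewrite mxE mulr_sumr scalar_re_sum; apply: ler_sum => j _.
apply: le_trans (scalar_re_le_norm _) _.
rewrite mulrCA !normrM scalar_norm_conj !ge0_scalar_reM//.
rewrite -[leRHS]mulr1; apply: ler_wpM2l; first exact: scalar_re_ge0.
by rewrite mulr_ile1// scalar_re_ge0.
Qed.

Lemma re_inner_homogeneous_bound T (r : R) x :
  (forall y, norm1 y <= 1 -> re (inner (T *m y) y) <= r) ->
  re (inner (T *m x) x) <= norm1 x ^+ 2 * r.
Proof.
(* Scaling a vector needs a factor in [F], so [l] is the 1-norm of [x] kept in [F], with
   [re l = norm1 x]. *)
move=> Tr; pose l : F := \sum_i `|x i 0|.
have l0 : 0 <= l by apply: sumr_ge0.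
have lE : re l = norm1 x by rewrite scalar_re_sum.
have [l_eq0|ln0] := eqVneq l 0.
  have -> : x = 0.
    apply/colP => i; rewrite mxE; apply/eqP; rewrite -normr_eq0.
    by move/eqP: l_eq0; rewrite psumr_eq0// => /allP/(_ i (mem_index_enum i)).
  rewrite mulmx0 innerE big1 ?scalar_re0; last by move=> i _; rewrite mxE mulr0.
  have -> : norm1 (0 : 'cV[F]_n) = 0.
    by rewrite /norm1 big1// => i _; rewrite mxE normr0 scalar_re0.
  by rewrite expr0n mul0r.
pose y := l^-1 *: x.
have xE : x = l *: y by rewrite scalerA divff// scale1r.
have y1 : norm1 y <= 1.
  rewrite le_eqVlt; apply/orP; left; apply/eqP.
  rewrite /norm1 -scalar_re_sum -(scalar_re1 R K) -(mulVf ln0) mulr_sumr.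
  congr (re _); apply: eq_bigr => i _.
  by rewrite mxE normrM normfV (ger0_norm l0).
have -> : inner (T *m x) x = inner (T *m (l *: y)) (l *: y) by rewrite -xE.
rewrite -scalemxAr innerZl innerZr (ge0_scalar_conj l0).
rewrite !ge0_scalar_reM// lE mulrA -expr2 ler_wpM2l ?sqr_ge0//.
exact: Tr.
Qed.

(** * The two inequalities in the extended reals *)

Local Open Scope ereal_scope.

Lemma rho1_le_pi_plus T : rho1 T <= pi_plus T.
Proof.
apply: ge_ereal_sup => _ [x /= x1 <-]; apply: ereal_sup_ubound.
exists (rank_one x); last by rewrite trace_mul_rank_one.
split; first exact: psd_rank_one.
by rewrite norm11_rank_one expr_le1// norm1_ge0.
Qed.

Lemma rho1_fin T : exists2 r : R, rho1 T = r%:E & (0 <= r)%R.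
Proof.
have ge0 : 0 <= rho1 T.
  apply: ereal_sup_ubound; exists 0%R; last first.
    by rewrite /= mulmx0 innerE big1 ?scalar_re0// => i _; rewrite mxE mulr0.
  by rewrite /= /norm1 big1// => i _; rewrite mxE normr0 scalar_re0.
have le : rho1 T <= (norm11 T)%:E.
  by apply: ge_ereal_sup => _ [x /= x1 <-]; rewrite lee_fin re_inner_le_norm11.
by case: (rho1 T) ge0 le => // r; rewrite lee_fin => r0 _; exists r.
Qed.

Lemma re_trace_le_gamma_sum T (r : R) N (x : 'I_N -> 'cV[F]_n) :
  rho1 T = r%:E ->
  (re (\tr (T *m \sum_k rank_one (x k))) <= (\sum_k norm1 (x k) ^+ 2) * r)%R.
Proof.
move=> Tr; rewrite mulmx_sumr raddf_sum scalar_re_sum mulr_suml.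
apply: ler_sum => k _; rewrite /= trace_mul_rank_one.
apply: re_inner_homogeneous_bound => y y1; rewrite -lee_fin -Tr.
by apply: ereal_sup_ubound; exists y.
Qed.

Lemma gamma_plus_ge0 A : 0 <= gamma_plus A.
Proof.
apply: le_ereal_inf_tmp => _ [N [x [_ ->]]].
by rewrite lee_fin sumr_ge0// => k _; rewrite sqr_ge0.
Qed.

Lemma gamma_ratio_le_C_const A : psd A -> A != 0%R ->
  gamma_plus A / (norm11 A)%:E <= C_const R K n.
Proof. by move=> pA A0; apply: ereal_sup_ubound; exists A. Qed.

Lemma C_const_ge0 A : psd A -> A != 0%R -> 0 <= C_const R K n.
Proof.
move=> pA A0; apply: le_trans (gamma_ratio_le_C_const pA A0).
by rewrite mule_ge0 ?gamma_plus_ge0// inve_ge0 lee_fin norm11_ge0.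
Qed.

(** For [n = 0] the supremum defining [C_const] ranges over the empty set and is [-oo]. A positive
    value of the form at some [x] excludes this, since [rank_one x] is then a nonzero psd matrix. *)
Lemma rho1_gt0_C_const_ge0 T : 0 < rho1 T -> 0 <= C_const R K n.
Proof.
move=> /ereal_sup_gt[_ [x _ <-]]; rewrite lte_fin => xT.
apply: (C_const_ge0 (psd_rank_one x)); apply: contraTneq xT => x0.
by rewrite -trace_mul_rank_one x0 mulmx0 mxtrace0 scalar_re0 ltxx.
Qed.

Lemma pi_plus_le_C_rho1 T : pi_plus T <= C_const R K n * rho1 T.
Proof.
have [r Tr r0] := rho1_fin T.
apply: ge_ereal_sup => _ [A /= [pA A1] <-].
have [r_eq0|r_neq0] := eqVneq r 0%R.
  have [N [x AE]] := psd_sum_rank_one pA.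
  have := re_trace_le_gamma_sum x Tr.
  (* The right-hand side is 0 by the convention that 0 times an infinite value is 0. *)
  by rewrite Tr -AE r_eq0 mulr0 mule0 lee_fin.
have {r_neq0}r0 : (0 < r)%R by rewrite lt0r r_neq0.
have C0 : 0 <= C_const R K n by apply: (@rho1_gt0_C_const_ge0 T); rewrite Tr.
rewrite Tr; set t := re _; have [t0|t0] := leP t 0%R.
  by apply: (@le_trans _ _ 0); rewrite ?lee_fin// mule_ge0// lee_fin ltW.
have A0 : A != 0%R.
  by apply: contraTneq t0 => A0; rewrite /t A0 mulmx0 mxtrace0 scalar_re0 ltxx.
have a0 := norm11_gt0 A0.
(* Dividing by [r] turns the trace bound into a lower bound on the cost of every decomposition,
   hence on the infimum. *)
have tg : (t / r)%:E <= gamma_plus A.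
  apply: le_ereal_inf_tmp => _ [N [x [AE ->]]].
  by rewrite lee_fin ler_pdivrMr// /t AE re_trace_le_gamma_sum.
have tC : (t / r)%:E <= C_const R K n.
  apply: le_trans (gamma_ratio_le_C_const pA A0).
  (* Since [0 < norm11 A <= 1], dividing by [norm11 A] can only increase the nonnegative [t / r]. *)
  rewrite inver gt_eqF//; apply: (@le_trans _ _ ((t / r)%:E * (norm11 A)^-1%:E)).
    rewrite -EFinM lee_fin; apply: ler_peMr; first by rewrite divr_ge0// ltW.
    by rewrite invf_ge1.
  by rewrite lee_wpmul2r// lee_fin invr_ge0 ltW.
have := lee_wpmul2r (_ : 0 <= r%:E) tC; rewrite -EFinM divfK ?gt_eqF//.
by apply; rewrite lee_fin ltW.
Qed.

End PositiveSemidefinite.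

Local Open Scope ereal_scope.

Theorem theorem4p1 (R : realType) (K : scalar_kind) (n : nat)
    (T : 'M[scalar_field R K]_n) (hT : selfadjoint T) :
  rho1 T <= pi_plus T /\ pi_plus T <= C_const R K n * rho1 T.
Proof. by split; [exact: rho1_le_pi_plus | exact: pi_plus_le_C_rho1]. Qed.
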